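(* Let $d\ge 1$ and $\gamma>0$. Suppose that $F\in\mathcal{C}^{3}(\mathbb{R}^{d},\mathbb{R}^{d})$ can be written as $F=\nabla U+\ell$ with $U\in\mathcal{C}^{4}(\mathbb{R}^{d},\mathbb{R})$ non-negative and $\ell\in\mathcal{C}^{3}(\mathbb{R}^{d},\mathbb{R}^{d})$, and that for some constants $\alpha\in(0,\infty)$ and $\beta\in(0,\gamma)$, $$\langle F(q),q\rangle\ \ge\ \alpha\left(|q|^{2}+U(q)\right)+\frac{|\ell(q)|^{2}}{\beta^{2}}\qquad\text{for all }q\in\mathbb{R}^{d}.$$ Then there exist constants $\kappa,\lambda>0$, independent of $x$, such that for all $x=(q,p)\in\mathbb{R}^{d}\times\mathbb{R}^{d}$, $$|X_{t}(x)|^{2}\le\kappa\left[|x|^{2}+U(q)\right]e^{-\lambda t}\qquad\text{for all }t\ge 0.$$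
   Context: For $x=(q,p)\in\mathbb{R}^{d}\times\mathbb{R}^{d}=\mathbb{R}^{2d}$, $(X_t(x))_{t\ge0}=((q_t(x),p_t(x)))_{t\ge 0}$ denotes the solution of the ordinary differential equation $$\frac{\mathrm{d}q_t}{\mathrm{d}t}=p_t,\qquad \frac{\mathrm{d}p_t}{\mathrm{d}t}=-F(q_t)-\gamma p_t,$$ started at $X_0(x)=x$ (the zero-noise underdamped Langevin dynamics). $|\cdot|$ and $\langle\cdot,\cdot\rangle$ denote the Euclidean norm and inner product. *)

(* Defs.v *)
From mathcomp Require Import all_boot all_order all_algebra.
From mathcomp Require Import all_classical all_reals all_analysis.

Set Implicit Arguments.
Unset Strict Implicit.
Unset Printing Implicit Defensive.

Import Order.TTheory GRing.Theory Num.Theory.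
Import numFieldNormedType.Exports.

Local Open Scope classical_set_scope.
Local Open Scope ring_scope.

Definition dot (R : realType) (n : nat) (u v : 'rV[R]_n) : R :=
  \sum_(i < n) u 0 i * v 0 i.

(* The library norm `|u| on row vectors is the sup norm, hence this one. *)
Definition enorm (R : realType) (n : nat) (u : 'rV[R]_n) : R :=
  Num.sqrt (dot u u).

Definition grad (R : realType) (n : nat) (U : 'rV[R]_n -> R) (x : 'rV[R]_n) :
  'rV[R]_n := \row_(i < n) 'D_(delta_mx 0 i) U x.

(* In finite dimension, x |-> 'd f x is of class C^k for the operator norm iff
   x |-> 'd f x v = 'D_v f x is of class C^k for every direction v. *)
Fixpoint Ck (R : realType) (n : nat) (W : normedModType R) (k : nat)
    (f : 'rV[R]_n -> W) : Prop :=
  if k is k'.+1 then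
    (forall x, differentiable f x) /\ (forall v, Ck k' ('D_v f))
  else continuous f.

(* X : R -> R^d * R^d is only constrained on [0, +oo[. At t = 0 we ask for
   right-continuity; when F is continuous, the right derivative at 0 then exists
   and satisfies the equation as well. *)
Definition langevin_solution (R : realType) (d : nat) (gamma : R)
    (F : 'rV[R]_d -> 'rV[R]_d) (x : 'rV[R]_d * 'rV[R]_d)
    (X : R -> 'rV[R]_d * 'rV[R]_d) : Prop :=
  [/\ X 0 = x,
      X t @[t --> 0^'+] --> X 0,
      forall t : R, 0 < t -> is_derive t 1 (fun s => (X s).1) (X t).2
    & forall t : R, 0 < t ->
        is_derive t 1 (fun s => (X s).2) (- F (X t).1 - gamma *: (X t).2)].

(* Main.v *)
Require Import Defs.
From mathcomp Require Import all_boot all_order all_algebra.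
From mathcomp Require Import all_classical all_reals all_analysis.
From mathcomp Require Import ring lra.

Import Order.TTheory GRing.Theory Num.Theory.
Import numFieldNormedType.Exports.

Local Open Scope classical_set_scope.
Local Open Scope ring_scope.

Set Implicit Arguments.
Unset Strict Implicit.

(** The theorem rests on the Lyapunov function
      V (q, p) = U q + |p|^2 / 2 + (gamma / 2) <q, p> + (gamma^2 / 4) |q|^2.
    The energy U + |p|^2 / 2 alone only dissipates |p|^2; the cross term
    (gamma / 2) <q, p> makes the confinement <F q, q> contribute, and the
    coefficient of |q|^2 is the one that cancels the remaining <q, p> terms.
    Along a solution, since F = grad U + ell,
      dV/dt = - <ell q, p> - (gamma / 2) |p|^2 - (gamma / 2) <F q, q>,
    where the gradient of U has disappeared ([is_derive_lyapunov]).

    By the drift condition the last term yields a negative multiple of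
    |q|^2 + U q, together with - gamma / (2 beta^2) |ell q|^2.  Young's
    inequality absorbs - <ell q, p> into that term at the price of
    beta^2 / (2 gamma) |p|^2, which is less than (gamma / 2) |p|^2 precisely
    because beta < gamma.  Hence dV/dt <= - m (|q|^2 + |p|^2 + U q) with m > 0
    ([lyapunov_dissipation]).

    Finally c (|q|^2 + |p|^2) <= V <= C (|q|^2 + |p|^2 + U q)
    ([lyapunov_ge], [lyapunov_le]).  So dV/dt <= - (m / C) V, and Gronwall's
    argument ([exponential_decay]) gives the estimate with kappa = C / c and
    lambda = m / C. *)

(** * Euclidean inner product *)

Section InnerProduct.
Context (R : realType) (n : nat).
Implicit Types (u v w : 'rV[R]_n) (a : R).

Lemma dotC u v : dot u v = dot v u.
Proof. by apply: eq_bigr => i _; rewrite mulrC. Qed.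

Lemma dotDl u v w : dot (u + v) w = dot u w + dot v w.
Proof. by rewrite -big_split; apply: eq_bigr => i _; rewrite mxE mulrDl. Qed.

Lemma dotZl a u v : dot (a *: u) v = a * dot u v.
Proof. by rewrite /dot mulr_sumr; apply: eq_bigr => i _; rewrite mxE mulrA. Qed.

Lemma dotNl u v : dot (- u) v = - dot u v.
Proof. by rewrite -scaleN1r dotZl mulN1r. Qed.

Lemma dot_ge0 u : 0 <= dot u u.
Proof. by apply: sumr_ge0 => i _; rewrite -expr2 sqr_ge0. Qed.

Lemma enorm_sqr u : enorm u ^+ 2 = dot u u.
Proof. by rewrite sqr_sqrtr// dot_ge0. Qed.

Lemma dot_addZ a u v :
  dot (u + a *: v) (u + a *: v) = dot u u + 2 * a * dot u v + a ^+ 2 * dot v v.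
Proof.
rewrite dotDl dotZl ![dot _ (u + _)]dotC !dotDl !dotZl (dotC v u); ring.
Qed.

End InnerProduct.

Lemma enorm_row_mx_sqr (R : realType) (d : nat) (q p : 'rV[R]_d) :
  enorm (row_mx q p) ^+ 2 = dot q q + dot p p.
Proof.
rewrite enorm_sqr /dot big_split_ord/=; congr (_ + _).
  by apply: eq_bigr => i _; rewrite row_mxEl.
by apply: eq_bigr => i _; rewrite row_mxEr.
Qed.

(** * Derivatives and limits of inner products *)

Lemma dot_grad (R : realType) (n : nat) (U : 'rV[R]_n -> R) (x v : 'rV[R]_n) :
  differentiable U x -> 'd U x v = dot (grad U x) v.
Proof.
move=> dU; rewrite {1}[v]row_sum_delta linear_sum; apply: eq_bigr => i _.
by rewrite linearZ /= mxE deriveE// mulrC.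
Qed.

Lemma is_derive_dot (R : realType) (n : nat) (f g : R -> 'rV[R]_n) (t : R)
    (df dg : 'rV[R]_n) :
  is_derive t 1 f df -> is_derive t 1 g dg ->
  is_derive t 1 (fun s => dot (f s) (g s)) (dot df (g t) + dot (f t) dg).
Proof.
have coord (h : R -> 'rV[R]_n) dh i : is_derive t 1 h dh ->
    is_derive t 1 (fun s => h s 0 i) (dh 0 i).
  move=> [hd <-]; apply: DeriveDef; first by move/derivable_mxP : hd; apply.
  by rewrite derive_mx// mxE.
move=> fdf gdg.
have -> : (fun s => dot (f s) (g s)) =
    \sum_(i < n) ((fun s => f s 0 i) * (fun s => g s 0 i)).
  by apply/funext => s; rewrite fct_sumE.
have fi i := coord _ _ i fdf.
have gi i := coord _ _ i gdg.
apply: is_derive_eq.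
by rewrite /dot -big_split; apply: eq_bigr => i _; rewrite addrC mulrC.
Qed.

Lemma is_derive_grad (R : realType) (n : nat) (U : 'rV[R]_n -> R)
    (f : R -> 'rV[R]_n) (t : R) (df : 'rV[R]_n) :
  differentiable U (f t) -> is_derive t 1 f df ->
  is_derive t 1 (fun s => U (f s)) (dot (grad U (f t)) df).
Proof.
move=> dU [/derivable1_diffP fd <-].
apply: DeriveDef.
  by apply/derivable1_diffP; apply: differentiable_comp.
rewrite deriveE; last exact: differentiable_comp.
by rewrite (diff_comp fd dU)/= dot_grad// deriveE.
Qed.

Lemma cvg_dot (R : realType) (n : nat) (T : Type) (G : set_system T)
    (FG : Filter G) (f g : T -> 'rV[R]_n) (a b : 'rV[R]_n) :
  f @ G --> a -> g @ G --> b -> dot (f s) (g s) @[s --> G] --> dot a b.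
Proof.
move=> fa gb; apply: cvg_big => [|i _]; first exact: add_continuous.
apply: cvgM.
  exact: (cvg_comp _ _ fa (@coord_continuous R 1 n 0 i a)).
exact: (cvg_comp _ _ gb (@coord_continuous R 1 n 0 i b)).
Qed.

(** * Gronwall's argument on the half-line *)

(** The product of [v] with [expR (lambda * t)] has a nonpositive derivative on
    the open half-line.  Right-continuity at 0 carries the monotonicity to the
    initial time. *)
Lemma exponential_decay (R : realType) (v dv : R -> R) (lambda : R) :
  v t @[t --> 0^'+] --> v 0 ->
  (forall t : R, 0 < t -> is_derive t 1 v (dv t)) ->
  (forall t : R, 0 < t -> dv t <= - lambda * v t) ->
  forall t : R, 0 <= t -> v t <= v 0 * expR (- lambda * t).
Proof.
move=> v0 dvE dvle t t0.
pose w s := v s * expR (lambda * s).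
have dw (s : R) : 0 < s -> is_derive s 1 w ((dv s + lambda * v s) * expR (lambda * s)).
  move=> s0.
  have dm : is_derive s 1 (fun r => lambda * r) lambda.
    by apply: is_derive_eq; rewrite scaler1.
  have de : is_derive s 1 (fun r => expR (lambda * r))
      (expR (lambda * s) * lambda).
    exact: (@is_derive1_comp R expR (fun r => lambda * r)).
  have dwE := is_deriveM (dvE s s0) de.
  apply: is_derive_eq.
  by rewrite /GRing.scale/= /comp; ring.
have wle : w t <= w 0.
  apply: (@ler0_derive1_nincry R w 0) => //.
  - move=> s; rewrite in_itv/= andbT => s0.
    by have := dw s s0; move=> [].
  - move=> s; rewrite in_itv/= andbT => s0.
    have h := dw s s0; rewrite derive1E derive_val.
    rewrite mulr_le0_ge0 ?expR_ge0//.
    by have := dvle s s0; lra.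
  - apply/continuous_within_itvcyP; split.
      move=> s; rewrite in_itv/= andbT => s0.
      apply: differentiable_continuous; apply/derivable1_diffP.
      by have := dw s s0; move=> [].
    apply: cvgM => //.
    apply: cvg_at_right_filter.
    apply: (continuous_comp (f := fun r : R => lambda * r) (g := expR)).
      exact: mulrl_continuous.
    exact: continuous_expR.
move: wle; rewrite /w mulr0 expR0 mulr1 => wle.
by rewrite mulNr expRN ler_pdivlMr ?expR_gt0.
Qed.

(** * The Lyapunov function *)

Definition lyapunov (R : realType) (d : nat) (gamma : R) (U : 'rV[R]_d -> R)
    (q p : 'rV[R]_d) : R :=
  U q + 2^-1 * dot p p + gamma / 2 * dot q p + gamma ^+ 2 / 4 * dot q q.

Section LyapunovFunction.
Context (R : realType) (d : nat) (gamma : R) (U : 'rV[R]_d -> R)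
  (gamma_gt0 : 0 < gamma) (U_ge0 : forall q, 0 <= U q).

(** Subtracting (7/16) |p + (4/7) gamma q|^2 from the quadratic part of the
    Lyapunov function leaves (1/16) |p|^2 + (3/28) gamma^2 |q|^2. *)
Lemma lyapunov_ge (q p : 'rV[R]_d) :
  Num.min 1 (gamma ^+ 2) / 16 * (dot q q + dot p p) <= lyapunov gamma U q p.
Proof.
have := dot_ge0 (p + (4 / 7 * gamma) *: q); rewrite dot_addZ (dotC p q) => sq.
have := U_ge0 q; have := dot_ge0 q; have := dot_ge0 p => P0 Q0 Uq0.
have m1 : Num.min 1 (gamma ^+ 2) <= 1 by rewrite ge_min lexx.
have m2 : Num.min 1 (gamma ^+ 2) <= gamma ^+ 2 by rewrite ge_min lexx orbT.
have := ler_wpM2r P0 m1; have := ler_wpM2r Q0 m2.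
have : 0 <= gamma ^+ 2 * dot q q by rewrite mulr_ge0// sqr_ge0.
rewrite /lyapunov; move: (Num.min _ _) sq => m; lra.
Qed.

(** The cross term is at most (|p|^2 + gamma^2 |q|^2) / 4, because
    |p - gamma q|^2 is nonnegative. *)
Lemma lyapunov_le (q p : 'rV[R]_d) :
  lyapunov gamma U q p <= (1 + gamma ^+ 2) * (dot q q + dot p p + U q).
Proof.
have := dot_ge0 (p + (- gamma) *: q); rewrite dot_addZ (dotC p q) => sq.
have := U_ge0 q; have := dot_ge0 q; have := dot_ge0 p => P0 Q0 Uq0.
have g2 := sqr_ge0 gamma.
have := mulr_ge0 g2 P0; have := mulr_ge0 g2 Q0; have := mulr_ge0 g2 Uq0.
rewrite /lyapunov; lra.
Qed.

Context (F ell : 'rV[R]_d -> 'rV[R]_d)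
  (F_decomp : forall q, F q = grad U q + ell q).

(** The potential force cancels between the derivatives of [U q] and of
    |p|^2 / 2, and the <q, p> terms cancel between those of
    (gamma / 2) <q, p> and (gamma^2 / 4) |q|^2. *)
Lemma is_derive_lyapunov (q p : R -> 'rV[R]_d) (t : R) :
  differentiable U (q t) -> is_derive t 1 q (p t) ->
  is_derive t 1 p (- F (q t) - gamma *: p t) ->
  is_derive t 1 (fun s => lyapunov gamma U (q s) (p s))
    (- dot (ell (q t)) (p t) - gamma / 2 * dot (p t) (p t)
     - gamma / 2 * dot (F (q t)) (q t)).
Proof.
move=> dU dq dp; rewrite /lyapunov.
have h1 := is_derive_grad dU dq.
have h2 := is_derive_dot dp dp.
have h3 := is_derive_dot dq dp.
have h4 := is_derive_dot dq dq.
apply: is_derive_eq.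
rewrite /GRing.scale/= ![dot _ (_ - _)]dotC !dotDl !dotNl !dotZl.
rewrite F_decomp !dotDl (dotC (q t) (p t)); by field.
Qed.

Context (alpha beta : R) (beta_gt0 : 0 < beta)
  (drift : forall q, alpha * (dot q q + U q)
    + dot (ell q) (ell q) / beta ^+ 2 <= dot (F q) q).

(** Half of gamma times the drift condition provides
    gamma / (2 beta^2) |ell q|^2, exactly what Young's inequality needs to
    control <ell q, p>; what is left of the |p|^2 term has coefficient
    gamma / 2 - beta^2 / (2 gamma) = (gamma^2 - beta^2) / (2 gamma). *)
Lemma lyapunov_dissipation (q p : 'rV[R]_d) :
  - dot (ell q) p - gamma / 2 * dot p p - gamma / 2 * dot (F q) q <=
  - Num.min ((gamma ^+ 2 - beta ^+ 2) / (2 * gamma)) (gamma * alpha / 2)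
    * (dot q q + dot p p + U q).
Proof.
have := U_ge0 q; have := dot_ge0 q; have := dot_ge0 p => P0 Q0 Uq0.
set m := Num.min _ _.
have m1 : m <= (gamma ^+ 2 - beta ^+ 2) / (2 * gamma) by rewrite ge_min lexx.
have m2 : m <= gamma * alpha / 2 by rewrite ge_min lexx orbT.
have dP := ler_wpM2r P0 m1; have dQU := ler_wpM2r (addr_ge0 Q0 Uq0) m2.
have dF : gamma / 2 * (alpha * (dot q q + U q)
    + dot (ell q) (ell q) / beta ^+ 2) <= gamma / 2 * dot (F q) q.
  by apply: ler_wpM2l; [rewrite divr_ge0 ?ltW|exact: drift].
have young : 0 <= gamma / (2 * beta ^+ 2) * dot (ell q) (ell q) + dot (ell q) p
    + beta ^+ 2 / (2 * gamma) * dot p p.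
  (* complete the square in ell q *)
  have -> : gamma / (2 * beta ^+ 2) * dot (ell q) (ell q) + dot (ell q) p
      + beta ^+ 2 / (2 * gamma) * dot p p
    = gamma / (2 * beta ^+ 2) * dot (ell q + (beta ^+ 2 / gamma) *: p)
                                    (ell q + (beta ^+ 2 / gamma) *: p).
    by rewrite dot_addZ; field; rewrite !gt_eqF.
  by rewrite mulr_ge0 ?dot_ge0// divr_ge0 ?ltW// mulr_gt0 ?exprn_gt0.
have e1 : (gamma ^+ 2 - beta ^+ 2) / (2 * gamma) * dot p p
  = gamma / 2 * dot p p - beta ^+ 2 / (2 * gamma) * dot p p.
  by field; rewrite gt_eqF.
have e2 : gamma / (2 * beta ^+ 2) * dot (ell q) (ell q)
  = gamma / 2 * (dot (ell q) (ell q) / beta ^+ 2).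
  by field; rewrite gt_eqF.
rewrite e1 in dP; rewrite e2 in young.
lra.
Qed.

End LyapunovFunction.

Lemma cvg_lyapunov (R : realType) (d : nat) (gamma : R) (U : 'rV[R]_d -> R)
    (T : Type) (G : set_system T) (FG : Filter G) (q p : T -> 'rV[R]_d)
    (a b : 'rV[R]_d) :
  {for a, continuous U} -> q @ G --> a -> p @ G --> b ->
  lyapunov gamma U (q s) (p s) @[s --> G] --> lyapunov gamma U a b.
Proof.
move=> Uc qa pb; apply: cvgD; first apply: cvgD; first apply: cvgD.
- exact: (cvg_comp _ _ qa Uc).
- by apply: cvgMr; exact: cvg_dot.
- by apply: cvgMr; exact: cvg_dot.
- by apply: cvgMr; exact: cvg_dot.
Qed.

Unset Implicit Arguments.

(** * Exponential convergence of the zero-noise dynamics *)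

Theorem theorem2p3 (R : realType) (d : nat) (hd : (1 <= d)%N)
    (gamma : R) (hgamma : 0 < gamma)
    (F : 'rV[R]_d -> 'rV[R]_d) (hF : Ck 3 F)
    (U : 'rV[R]_d -> R) (hU : Ck 4 U) (hU0 : forall q, 0 <= U q)
    (ell : 'rV[R]_d -> 'rV[R]_d) (hell : Ck 3 ell)
    (hdecomp : forall q, F q = grad U q + ell q)
    (alpha beta : R) (halpha : 0 < alpha) (hbeta0 : 0 < beta)
    (hbeta : beta < gamma)
    (hdrift : forall q : 'rV[R]_d,
      alpha * (enorm q ^+ 2 + U q) + enorm (ell q) ^+ 2 / beta ^+ 2
        <= dot (F q) q) :
  exists kappa lambda : R, [/\ 0 < kappa, 0 < lambda &
    forall (q p : 'rV[R]_d) (X : R -> 'rV[R]_d * 'rV[R]_d),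
      langevin_solution gamma F (q, p) X ->
      forall t : R, 0 <= t ->
        enorm (row_mx (X t).1 (X t).2) ^+ 2
          <= kappa * (enorm (row_mx q p) ^+ 2 + U q) * expR (- lambda * t)].
Proof.
have drift q : alpha * (dot q q + U q) + dot (ell q) (ell q) / beta ^+ 2
    <= dot (F q) q by rewrite -!enorm_sqr.
have dU x : differentiable U x by case: hU.
have g2_gt0 : 0 < gamma ^+ 2 by rewrite exprn_gt0.
pose m := Num.min ((gamma ^+ 2 - beta ^+ 2) / (2 * gamma)) (gamma * alpha / 2).
pose c := Num.min 1 (gamma ^+ 2) / 16.
pose C := 1 + gamma ^+ 2.
have m_gt0 : 0 < m.
  rewrite lt_min !divr_gt0 ?mulr_gt0// subr_gt0.
  by rewrite ltr_pXn2r// nnegrE ltW.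
have c_gt0 : 0 < c.
  by rewrite divr_gt0// lt_min ltr01.
have C_gt0 : 0 < C by rewrite addr_gt0.
exists (C / c), (m / C);
  split=> [||q p X [X0 Xcvg dq dp] t t0]; try exact: divr_gt0.
pose v s := lyapunov gamma U (X s).1 (X s).2.
have v_decay : v t <= v 0 * expR (- (m / C) * t).
  pose dv s := - dot (ell (X s).1) (X s).2 - gamma / 2 * dot (X s).2 (X s).2
    - gamma / 2 * dot (F (X s).1) (X s).1.
  have dvE (s : R) : 0 < s -> is_derive s 1 v (dv s).
    move=> s0; exact: (is_derive_lyapunov (q := fst \o X) (p := snd \o X)
      hdecomp (dU _) (dq s s0) (dp s s0)).
  apply: (exponential_decay _ dvE) => // [|s s0].
    apply: cvg_lyapunov.
    - exact/differentiable_continuous.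
    - by apply: (cvg_comp _ _ Xcvg); exact: cvg_fst.
    - by apply: (cvg_comp _ _ Xcvg); exact: cvg_snd.
  apply: le_trans (lyapunov_dissipation hgamma hU0 hbeta0 drift _ _) _.
  rewrite -/m !mulNr lerN2 -mulrA ler_pM2l// mulrC ler_pdivrMr// mulrC.
  exact: lyapunov_le.
have v0 : v 0 <= C * (dot q q + dot p p + U q).
  by rewrite /v X0; exact: lyapunov_le.
have vt : c * (dot (X t).1 (X t).1 + dot (X t).2 (X t).2) <= v t.
  exact: lyapunov_ge.
rewrite !enorm_row_mx_sqr [C / c]mulrC -!mulrA ler_pdivlMl//.
apply: (le_trans vt); apply: (le_trans v_decay).
by rewrite mulrA ler_wpM2r ?expR_ge0.
Qed.
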